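(* Let $\alpha\in\mathbb{C}$, and let $(h_n)_{n\ge 0}$ be the sequence defined by $h_0=0$ and $h_n=n^\alpha=\exp(\alpha\log n)$ for $n\ge 1$, where $\log n$ is the real natural logarithm. Then $(h_n)_{n\ge 0}$ is holonomic if and only if $\alpha\in\mathbb{Z}$.
   Context: A sequence $(f_n)_{n\ge0}$ of complex numbers is called holonomic (or $P$-recursive) if there exist an integer $d\ge 0$ and polynomials $p_0,\dots,p_d\in\mathbb{C}[X]$, not all zero, such that $p_0(n)f_{n+d}+p_1(n)f_{n+d-1}+\cdots+p_d(n)f_n=0$ for all integers $n\ge 0$. *)

(* Defs.v *)
(* MathComp / MathComp-Analysis; complex numbers are R[i] for R : realType. *)
From HB Require Import structures.
From mathcomp Require Import all_boot all_order all_algebra.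
From mathcomp Require Import complex.
From mathcomp Require Import all_classical all_reals all_analysis.

Set Implicit Arguments.
Unset Strict Implicit.
Unset Printing Implicit Defensive.

Import Order.TTheory GRing.Theory Num.Theory.
Local Open Scope ring_scope.
Local Open Scope complex_scope.

(* exp (a + i b) = e^a (cos b + i sin b); the complex exponential is not
   available in the libraries. *)
Definition cexp (R : realType) (z : R[i]) : R[i] :=
  let: a +i* b := z in (expR a * cos b) +i* (expR a * sin b).

Definition power_seq (R : realType) (alpha : R[i]) (n : nat) : R[i] :=
  if n == 0%N then 0 else cexp (alpha * (ln (n%:R : R))%:C).

(* The sum is p_0(n) f_{n+d} + ... + p_d(n) f_n; d - i never truncates. *)
Definition holonomic (R : realType) (f : nat -> R[i]) : Prop :=
  exists (d : nat) (p : 'I_d.+1 -> {poly R[i]}),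
    (exists i, p i != 0) /\
    forall n : nat, \sum_(i < d.+1) (p i).[n%:R] * f (n + (d - i))%N = 0.

(* Main.v *)
Require Import Defs.
From mathcomp Require Import all_boot all_order all_algebra.
From mathcomp Require Import complex.
From mathcomp Require Import all_classical all_reals all_analysis.
From mathcomp Require Import ring lra zify.

(* If [a] is an integer, [n A(n) h_(n+1) = n B(n) h_n] for suitable polynomials
   [A] and [B].  Conversely, put [t = 1/n] in a relation
   [\sum_j q_j(n) (n + j)^a = 0]: it becomes [\sum_j Q_j(t) (1 + j t)^a = 0] for
   polynomials [Q_j].  As this holds for arbitrarily small [t], the Taylor
   expansions at [0] cancel, that is,
   [\sum_j \sum_i Q_j`_i binom(a, k - i) j^(k - i) = 0] for every [k].  If [a] is not
   an integer, dividing by a common nonzero factor of the [binom(a, k - i)] turns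
   this into [\sum_j R_j(k) j^k = 0] with polynomials [R_j], whence [R_j = 0] for
   [j > 0].  The coefficients of [R_j] over the [Q_j`_i] form a system which is
   triangular after evaluation at [k = 0, 1, 2, ...], with a nonzero diagonal
   since [a] is not an integer, so [Q_j = 0]. *)

Set Implicit Arguments.
Unset Strict Implicit.
Unset Printing Implicit Defensive.

Import Order.TTheory GRing.Theory Num.Theory numFieldNormedType.Exports.
Local Open Scope ring_scope.
Local Open Scope complex_scope.

(** * Polynomials and exponential polynomials *)

Section Algebra.

Variable F : numFieldType.
Implicit Types (a : F) (p : {poly F}).

Lemma poly_eq0_cofinite p n0 :
  (forall n, (n0 <= n)%N -> p.[n%:R] = 0) -> p = 0.
Proof.
move=> p0; apply/eqP/negPn/negP => pN0.
pose rs := [seq n%:R : F | n <- iota n0 (size p)].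
have : (size rs < size p)%N.
  apply: max_poly_roots => //; last first.
    by rewrite map_inj_uniq ?iota_uniq// => i j /eqP; rewrite eqr_nat => /eqP.
  apply/allP => x /mapP[n]; rewrite mem_iota => /andP[n0n _] ->.
  by rewrite /root p0.
by rewrite size_map size_iota ltnn.
Qed.

(** Used to pass from n to t = 1/n. Reversal is taken with respect to a bound [N] rather than the
    exact degree, so that one power [x ^+ N] serves all the coefficients of a relation. *)
Lemma horner_rev_poly N p x : (size p <= N.+1)%N -> x != 0 ->
  x ^+ N * (\poly_(i < N.+1) p`_(N - i)).[x^-1] = p.[x].
Proof.
move=> sp x0; rewrite horner_poly (horner_coef_wide _ sp) mulr_sumr.
rewrite [RHS](reindex_inj rev_ord_inj)/=; apply: eq_bigr => i _.
rewrite subSS mulrCA exprVn; congr (_ * _).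
by rewrite -[X in x ^+ X](subnK (leq_ord i)) exprD mulfK// expf_neq0.
Qed.

Lemma size_twisted_diff (c b : F) p :
  (size (c *: (p \Po ('X + 1)) - b *: p)%R <= size p)%N.
Proof.
apply: leq_trans (size_polyD _ _) _; rewrite size_polyN geq_max.
rewrite (leq_trans (size_scale_leq b p))// (leq_trans (size_scale_leq _ _))//.
by rewrite size_comp_poly2// size_XaddC.
Qed.

(** The shift by 1 keeps the leading coefficient. Hence the degree drops when [c = b] and [p] is
    nonzero, while for [c != b] the difference vanishes only if [p] does. *)
Lemma coef_twisted_diff (c b : F) p :
  (c *: (p \Po ('X + 1)) - b *: p)`_(size p).-1 = (c - b) * lead_coef p.
Proof.
rewrite coefB !coefZ mulrBl; congr (_ * _ - _).
have s : size (p \Po ('X + 1)) = size p by rewrite size_comp_poly2// size_XaddC.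
rewrite -{1}s -/(lead_coef _) lead_coef_comp ?size_XaddC//.
by rewrite lead_coefXaddC expr1n mulr1.
Qed.

(* Induction on the total size of the [P i]: the operator [u |-> u (n + 1) - c i * u n]
   lowers the degree of [P i] and preserves those of the other coefficients. *)
Lemma exp_poly_eq0 (I : finType) (c : I -> F) (P : I -> {poly F}) n0 :
    injective c ->
    (forall n, (n0 <= n)%N -> \sum_i (P i).[n%:R] * c i ^+ n = 0) ->
  forall i, c i != 0 -> P i = 0.
Proof.
move=> c_inj; have [m] := ubnP (\sum_i size (P i))%N.
elim: m P n0 => // m IHm P n0 sP P0 i ci0.
apply/eqP/negPn/negP => Pi0.
pose Q j := c j *: (P j \Po ('X + 1)) - c i *: P j.
have Q0 : forall j, c j != 0 -> Q j = 0.
  apply: (IHm Q n0).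
    rewrite -ltnS; apply: leq_trans sP; rewrite ltnS.
    rewrite (bigD1 i)//= [leqRHS](bigD1 i)//= -addSn leq_add//; last first.
      by apply: leq_sum => j _; exact: size_twisted_diff.
    have := size_twisted_diff (c i) (c i) (P i);
      rewrite leq_eqVlt -/(Q i) => /orP[/eqP sQ|//].
    have := coef_twisted_diff (c i) (c i) (P i).
    rewrite subrr mul0r -/(Q i) -sQ => /eqP;
      rewrite -/(lead_coef _) lead_coef_eq0 => /eqP Qi0.
    by move: sQ Pi0; rewrite Qi0 size_poly0 => /esym/eqP; rewrite size_poly_eq0 => ->.
  move=> n n0n; have := P0 n.+1 (leqW n0n); have := P0 n n0n.
  move=> /(congr1 (fun x => c i * x)) + e; rewrite mulr0 -[RHS]e mulr_sumr => {}e.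
  rewrite /Q; under eq_bigr do
    rewrite hornerD hornerN !hornerZ horner_comp hornerD hornerX hornerC mulrBl.
  rewrite sumrB; apply/eqP; rewrite subr_eq0; apply/eqP/esym.
  rewrite -natr1 in e; move: e.
  under eq_bigr do rewrite mulrA; move=> ->.
  by apply: eq_bigr => j _; rewrite exprS -mulrA mulrCA !mulrA.
have Pj0 j : j != i -> c j != 0 -> P j = 0.
  move=> ji cj0; apply/eqP; rewrite -lead_coef_eq0.
  have := coef_twisted_diff (c j) (c i) (P j); rewrite -/(Q j) Q0// coef0.
  move=> /esym/eqP; rewrite mulf_eq0 subr_eq0 => /orP[/eqP/c_inj/eqP|//].
  by rewrite (negPf ji).
suff : P i = 0 by apply/eqP.
(* Starting at [n0.+1] makes [n] positive, so that a term with [c j = 0], about which [Pj0] says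
   nothing, is killed by [0 ^+ n]. *)
apply: (@poly_eq0_cofinite _ n0.+1) => n n0n.
have := P0 n (ltnW n0n); rewrite (bigD1 i)//= big1 ?addr0 => [/eqP|j ji].
  by rewrite mulf_eq0 expf_eq0 (negPf ci0) andbF orbF => /eqP.
have [->|/(Pj0 _ ji)->] := eqVneq (c j) 0; last by rewrite horner0 mul0r.
by rewrite expr0n gtn_eqF ?mulr0//; case: n n0n.
Qed.

(** * Generalized binomial coefficients binom(a, k) *)

Definition gbin a k := \prod_(l < k) ((a - l%:R) / l.+1%:R).

Lemma gbinS a k : k.+1%:R * gbin a k.+1 = (a - k%:R) * gbin a k.
Proof.
by rewrite /gbin big_ord_recr/= mulrCA [X in _ * X]mulrC divfK ?pnatr_eq0// mulrC.
Qed.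

(** The full binomial series solves (1 + X) S' = a S. By [gbinS] the coefficients below degree [K]
    still cancel after truncation, and only the boundary term remains. *)
Lemma gbin_poly_ode a K (S := \poly_(k < K.+1) gbin a k) :
  (1 + 'X) * S^`() - a *: S = - (K.+1%:R * gbin a K.+1) *: 'X^K.
Proof.
apply/polyP => i; rewrite mulrDl mul1r coefB coefD coefXM !coefZ coefXn.
have -> : (if i == 0%N then 0 else S^`()`_i.-1) = S`_i *+ i.
  by case: i => [|i]; rewrite ?mulr0n// coef_deriv.
rewrite coef_deriv !coef_poly !ltnS.
case: ltngtP => iK; rewrite ?mulr0 ?mulr1 ?ltnS ?iK ?(ltnW iK) ?mul0rn ?addr0 ?subr0//.
- by rewrite -[gbin a i.+1 *+ _]mulr_natl -[gbin a i *+ _]mulr_natl gbinS; ring.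
- by rewrite gbinS -[gbin a K *+ _]mulr_natl; ring.
Qed.

Lemma fact_gbin a k : k`!%:R * gbin a k = \prod_(0 <= l < k) (a - l%:R).
Proof.
elim: k => [|k IH]; first by rewrite /gbin big_ord0 big_nil mulr1.
by rewrite factS natrM mulrAC gbinS -mulrA [gbin a k * _]mulrC IH mulrC big_nat_recr.
Qed.

(** At [k >= N] the second product is k!/(k - i)!, and the first collects the factors a - l with k -
    N <= l < k - i, where l = k - m - 1. *)
Definition gbin_poly a N i : {poly F} :=
  \prod_(i <= m < N) ((a + m.+1%:R)%:P - 'X) * \prod_(m < i) ('X - m%:R%:P).

(* Up to a factor independent of [i], [gbin a (k - i)] is a polynomial in [k]. *)
Lemma gbin_polyP a N i k : (i <= N <= k)%N ->
  k`!%:R * gbin a (k - i) =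
  \prod_(0 <= l < k - N) (a - l%:R) * (gbin_poly a N i).[k%:R].
Proof.
move=> /andP[iN Nk]; have ik := leq_trans iN Nk.
rewrite -(ffact_fact ik) natrM -mulrA fact_gbin mulrC ffact_prod natr_prod.
rewrite hornerM !horner_prod mulrA; congr (_ * _); last first.
  apply: eq_bigr => m _; rewrite !hornerE natrB//.
  by rewrite ltnW// (leq_trans (ltn_ord m)).
elim: N iN Nk => [|N IH].
  by rewrite leqn0 => /eqP -> _; rewrite [X in _ * X]big_geq// mulr1.
rewrite leq_eqVlt => /orP[/eqP ->|]; first by rewrite [X in _ * X]big_geq// mulr1.
rewrite ltnS => iN Nk; rewrite IH ?(ltnW Nk)// [in RHS]big_nat_recr//=.
have -> : (k - N)%N = (k - N.+1).+1 by lia.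
rewrite big_nat_recr//= [in RHS]mulrA [RHS]mulrAC; congr (_ * _ * _).
by rewrite !hornerE natrB//; ring.
Qed.

Lemma gbin_poly_gt a N i n : (n < i)%N -> (gbin_poly a N i).[n%:R] = 0.
Proof.
move=> ni; rewrite hornerM [X in _ * X]horner_prod (bigD1 (Ordinal ni))//=.
by rewrite hornerD hornerN hornerX hornerC subrr mul0r mulr0.
Qed.

(** At [i] the second product is i!, and a zero factor in the first would give a = i - m - 1, an
    integer. *)
Lemma gbin_poly_diag a N i : ~ (exists m : int, a = m%:~R) ->
  (gbin_poly a N i).[i%:R] != 0.
Proof.
move=> aNint; rewrite hornerM !horner_prod mulf_neq0//.
  rewrite prodf_seq_neq0; apply/allP => m _; rewrite !hornerE /=.
  apply/eqP => e; apply: aNint; exists (i%:Z - m.+1%:Z).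
  rewrite intrB -!pmulrn; apply/eqP.
  by rewrite eq_sym subr_eq eq_sym -subr_eq0; apply/eqP.
apply/prodf_neq0 => m _; rewrite !hornerE subr_eq0 eqr_nat.
by rewrite gtn_eqF.
Qed.

(** The hypothesis is the vanishing of the Taylor coefficients at 0 of the sum of the Q_j(t) (1 + j
    t)^a. It is used only for large [k], where [j = 0] contributes nothing. *)
Lemma gbin_relation_eq0 a d (Q : nat -> {poly F}) :
    ~ (exists m : int, a = m%:~R) ->
    (forall k, \sum_(j < d.+1) \sum_(i < k.+1)
       (Q j)`_i * (gbin a (k - i) * j%:R ^+ (k - i)) = 0) ->
  forall j : 'I_d.+1, (0 < j)%N -> Q j = 0.
Proof.
move=> aNint Q0.
pose N := \max_(j < d.+1) size (Q j).
(* Splitting j^(k - i) as j^k / j^i turns the relation into an exponential polynomial with bases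
   [j]. *)
pose R (j : 'I_d.+1) : {poly F} :=
  \sum_(i < N) ((Q j)`_i / j%:R ^+ i) *: gbin_poly a N i.
(* The junk term [j = 0] of [R] is harmless: its weight [0 ^+ n] vanishes. *)
have R0 (j : 'I_d.+1) : (0 < j)%N -> R j = 0.
  move=> j0; apply: (@exp_poly_eq0 _ (fun j : 'I_d.+1 => j%:R) R N.+1).
  - by move=> x y /eqP; rewrite eqr_nat => /eqP/val_inj.
  - move=> n Nn; have nN : (N <= n)%N by apply: ltnW.
    have := Q0 n; move=> /(congr1 (fun x => n`!%:R * x)); rewrite mulr0 mulr_sumr.
    have pN0 : \prod_(0 <= l < n - N) (a - l%:R) != 0.
      rewrite prodf_seq_neq0; apply/allP => m _ /=; rewrite subr_eq0.
      by apply/eqP => e; apply: aNint; exists m.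
    move=> e; apply: (mulfI pN0); rewrite mulr0 -[RHS]e mulr_sumr.
    apply: eq_bigr => x _.
    rewrite horner_sum mulr_suml mulr_sumr.
    rewrite (big_ord_widen n.+1 (fun i => (\prod_(0 <= l < n - N) (a - l%:R) *
      ((((Q x)`_i / x%:R ^+ i) *: gbin_poly a N i).[n%:R] * x%:R ^+ n)))) 1?ltnW//.
    rewrite mulr_sumr [RHS](bigID (fun i : 'I_n.+1 => (i < N)%N))/=.
    rewrite [X in _ = _ + X]big1 ?addr0.
      apply: eq_bigr => i iN; rewrite [RHS]mulrCA [X in _ = _ * X]mulrA.
      rewrite (gbin_polyP a (N := N)) ?(ltnW iN)// hornerZ.
      have -> : (x%:R ^+ n : F) = x%:R ^+ i * x%:R ^+ (n - i).
        by rewrite -exprD subnKC// (leq_trans (ltnW iN)).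
      have [->|x0] := eqVneq (x%:R : F) 0.
        by rewrite [0 ^+ (n - i)]expr0n subn_eq0 leqNgt (leq_trans iN)// !mulr0.
      field.
      by rewrite expf_neq0.
    move=> i; rewrite -leqNgt => Ni; rewrite nth_default ?mul0r ?mulr0//.
    by rewrite (leq_trans _ Ni)// (leq_bigmax x).
  - by rewrite pnatr_eq0 -lt0n.
move=> j j0; apply/polyP => i; rewrite coef0.
have [Ni|] := leqP N i.
  by rewrite nth_default// (leq_trans _ Ni)// (leq_bigmax j).
(* In [R j] evaluated at [i], the terms below [i] vanish by induction and those above by
   [gbin_poly_gt]; the diagonal factor is nonzero. *)
elim/ltn_ind: i => i IH iN.
have /(congr1 (fun p => p.[i%:R])) := R0 j j0.
rewrite horner0 horner_sum (bigD1 (Ordinal iN))//= big1 ?addr0 => [/eqP|l li].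
  rewrite hornerZ !mulf_eq0 (negPf (gbin_poly_diag _ _ aNint)) orbF.
  by rewrite invr_eq0 expf_eq0 pnatr_eq0 (gtn_eqF j0) andbF orbF => /eqP.
rewrite hornerZ; case: (ltngtP l i) => [/IH->//|/gbin_poly_gt->|e];
  rewrite ?mul0r ?mulr0//.
by rewrite -val_eqE/= e eqxx in li.
Qed.

End Algebra.

Local Notation Re := (@complex.Re _).
Local Notation Im := (@complex.Im _).

(** * Polynomials that are small at the points 1/n *)

Section SmallPolynomial.

Variable R : realType.

Lemma horner_bounded (p : {poly R[i]}) :
  exists2 M : R, 0 <= M & forall x : R[i], `|x| <= 1 -> `|p.[x]| <= M%:C.
Proof.
exists (\sum_(i < size p) Re `|p`_i|).
  by apply: sumr_ge0 => i _; rewrite normc_def /= sqrtr_ge0.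
move=> x x1; rewrite horner_coef (le_trans (ler_norm_sum _ _ _))// rmorph_sum.
apply: ler_sum => i _; rewrite normrM normrX.
rewrite [leRHS](_ : _ = `|p`_i|); last by rewrite [in RHS]normc_def normc_def.
by rewrite -[leRHS]mulr1 ler_wpM2l// exprn_ile1.
Qed.

Lemma eq0_le_invn (c : R[i]) (M : R) n0 :
  (forall n, (n0 < n)%N -> `|c| <= M%:C / n%:R) -> c = 0.
Proof.
move=> cM; apply/eqP/negPn/negP; rewrite -normr_gt0.
rewrite normc_def -complexr0 -/(real_complex _ _) in cM *; rewrite ltcR => x0.
set x := Num.sqrt _ in x0 cM.
pose n := (maxn n0 (Num.truncn (M / x))).+1.
have := cM n; rewrite ltnS leq_maxl => /(_ isT).
rewrite ler_pdivlMr ?ltr0n// -(rmorph_nat (real_complex R)) -rmorphM lecR.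
apply/negP; rewrite -ltNge mulrC -ltr_pdivrMr//.
apply: lt_le_trans (truncnS_gt _) _.
by rewrite ler_nat ltnS leq_maxr.
Qed.

(** Write p = q X + c. Both p(1/n) and q(1/n)/n are O(1/n), so c = 0; then q satisfies the same
    bound with one power of 1/n fewer. *)
Lemma coef_eq0_small K (p : {poly R[i]}) (M : R) n0 :
    (forall n, (n0 < n)%N -> `|p.[n%:R^-1]| <= M%:C / n%:R ^+ K) ->
  forall i, (i < K)%N -> p`_i = 0.
Proof.
elim: K p M => // K IH p M.
elim/poly_ind: p => [|q c _] small; first by move=> i _; rewrite coef0.
have c_le n : `|c| <= `|(q * 'X + c%:P).[n%:R^-1]| + `|q.[n%:R^-1] / n%:R|.
  rewrite !hornerE -{1}[c](addKr (q.[n%:R^-1] / n%:R)) addrC.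
  by rewrite (le_trans (ler_normD _ _))// normrN lerD2r addrC.
have [M' M'0 qM'] := horner_bounded q.
have c0 : c = 0.
  apply: (@eq0_le_invn _ (`|M| + M') n0) => n n0n.
  apply: le_trans (c_le n) _; rewrite rmorphD mulrDl lerD//.
    apply: le_trans (small n n0n) _.
    have n1 : 1 <= n%:R :> R[i] by rewrite ler1n (leq_trans _ n0n).
    have n0' : 0 < n%:R :> R[i] by exact: lt_le_trans n1.
    (* [M] may be negative, so its absolute value is needed before the power of n is lowered to
       1. *)
    apply: (@le_trans _ _ (`|M|%:C / n%:R ^+ K.+1)).
      by rewrite ler_pM2r ?invr_gt0 ?exprn_gt0// lecR ler_norm.
    by rewrite ler_wpM2l ?ler0c// lef_pV2 ?posrE ?exprn_gt0// ler_eXnr.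
  rewrite normrM ler_pM// ?qM'//.
    by rewrite ger0_norm ?invf_le1 ?ltr0n ?ler1n ?invr_ge0 ?ler0n// (leq_trans _ n0n).
  by rewrite ger0_norm ?invr_ge0.
subst c; case=> [|i iK]; first by rewrite coefD coefMX coefC addr0.
rewrite addr0 coefMX /=; apply: (IH q M) => // n n0n.
have := small n n0n; rewrite !hornerE normrM exprS invfM mulrCA.
rewrite [X in _ * X <= _]ger0_norm ?invr_ge0// mulrC ler_pM2l//.
by rewrite invr_gt0 ltr0n (leq_trans _ n0n).
Qed.

End SmallPolynomial.

(** * Complex powers of 1 + t and their Taylor expansion *)

Section Calculus.

Variable R : realType.
Implicit Types (f g : R -> R[i]) (x t : R) (a b df dg : R[i]).

(** Componentwise, so that the real mean value theorem applies to each part. *)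
Definition is_cderive x f df :=
  is_derive x 1 (Re \o f) (Re df) /\
  is_derive x 1 (Im \o f) (Im df).

Lemma is_cderiveM x f g df dg : is_cderive x f df -> is_cderive x g dg ->
  is_cderive x (f \* g) (df * g x + f x * dg).
Proof.
move=> [fr fi] [gr gi]; split.
  rewrite (_ : _ \o _ =
      ((Re \o f) * (Re \o g) - (Im \o f) * (Im \o g))%R).
    apply: (is_derive_eq (is_deriveB (is_deriveM fr gr) (is_deriveM fi gi))) => /=.
    case: (f x) (g x) df dg {fr fi gr gi} => [? ?] [? ?] [? ?] [? ?] /=.
    by rewrite /GRing.scale/=; ring.
  by apply/funext => y /=; rewrite !fctE; case: (f y) (g y) => [? ?] [? ?].
rewrite (_ : _ \o _ =
    ((Re \o f) * (Im \o g) + (Im \o f) * (Re \o g))%R).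
  apply: (is_derive_eq (is_deriveD (is_deriveM fr gi) (is_deriveM fi gr))) => /=.
  case: (f x) (g x) df dg {fr fi gr gi} => [? ?] [? ?] [? ?] [? ?] /=.
  by rewrite /GRing.scale/=; ring.
by apply/funext => y /=; rewrite !fctE; case: (f y) (g y) => [? ?] [? ?].
Qed.

Lemma is_cderiveD_cst x f df c : is_cderive x f df ->
  is_cderive x (fun y => f y + c) df.
Proof.
move=> [fr fi]; split.
  rewrite (_ : _ \o _ = ((Re \o f) + cst (Re c))%R).
    by apply: is_derive_eq; rewrite addr0.
  by apply/funext => y /=; rewrite !fctE raddfD.
rewrite (_ : _ \o _ = ((Im \o f) + cst (Im c))%R).
  by apply: is_derive_eq; rewrite addr0.
by apply/funext => y /=; rewrite !fctE raddfD.
Qed.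

Lemma is_cderive_horner x (p : {poly R[i]}) :
  is_cderive x (fun y => p.[y%:C]) p^`().[x%:C].
Proof.
elim/poly_ind: p => [|p c IH].
  by split; under [_ \o _]funext do rewrite /= horner0; rewrite deriv0 horner0;
    exact: is_derive_cst.
have idx : is_cderive x (fun y => y%:C) 1 by split;
  [exact: is_derive_id|exact: is_derive_cst].
have := is_cderiveD_cst c (is_cderiveM IH idx).
rewrite derivMXaddC hornerD hornerMX mulr1 addrC.
by congr is_cderive; apply/funext => y; rewrite !hornerE.
Qed.

(* [(1 + t)^a]; only meaningful for [-1 < t]. *)
Definition cpow a t : R[i] := cexp (a * (ln (1 + t))%:C).

Lemma cexpD a b : cexp (a + b) = cexp a * cexp b.
Proof.
case: a b => [a1 a2] [b1 b2]; rewrite /cexp; simpc; rewrite /=.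
by rewrite expRD cosD sinD; congr (_ +i* _); ring.
Qed.

Lemma cpowD a b t : cpow (a + b) t = cpow a t * cpow b t.
Proof. by rewrite /cpow mulrDl cexpD. Qed.

Lemma is_cderive_cpow x a : -1 < x ->
  is_cderive x (cpow a) (a / (1 + x)%:C * cpow a x).
Proof.
case: a => a1 a2 x1.
have x0 : 0 < 1 + x by lra.
have dln : is_derive x 1 (fun y => ln (1 + y)) (1 + x)^-1.
  have d1 : is_derive x 1 (fun y : R => 1 + y) 1.
    have := is_deriveD (is_derive_cst (1 : R) x (1 : R)) (is_derive_id x (1 : R)).
    by rewrite add0r.
  by have := is_derive1_comp (is_derive1_ln x0) d1; rewrite mulr1.
have dcln (c : R) : is_derive x 1 (fun y => c * ln (1 + y)) (c / (1 + x)).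
  exact: is_deriveZ.
have de := is_derive1_comp (is_derive_expR _) (dcln a1).
have dc := is_derive1_comp (is_derive_cos _) (dcln a2).
have ds := is_derive1_comp (is_derive_sin _) (dcln a2).
rewrite -(rmorphV (real_complex R)) ?unitfE ?gt_eqF//.
split.
  rewrite (_ : _ \o _ = ((expR \o (fun y => a1 * ln (1 + y))) *
      (cos \o (fun y => a2 * ln (1 + y))))%R).
    apply: is_derive_eq; rewrite /cpow /cexp; simpc; rewrite /= /GRing.scale/=; ring.
  by apply/funext => y /=; rewrite /cpow/cexp; simpc.
rewrite (_ : _ \o _ = ((expR \o (fun y => a1 * ln (1 + y))) *
    (sin \o (fun y => a2 * ln (1 + y))))%R).
  apply: is_derive_eq; rewrite /cpow /cexp; simpc; rewrite /= /GRing.scale/=; ring.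
by apply/funext => y /=; rewrite /cpow/cexp; simpc.
Qed.

Lemma norm_cexp (z : R[i]) : `|cexp z| = (expR (Re z))%:C.
Proof.
case: z => u v; rewrite normc_def /= !exprMn -mulrDr cos2Dsin2 mulr1.
by rewrite sqrtr_sqr ger0_norm// expR_ge0.
Qed.

Lemma norm_le_ReIm (z : R[i]) : `|z| <= (`|Re z| + `|Im z|)%:C.
Proof.
rewrite normc_def lecR; set u := Re z; set v := Im z.
rewrite -[leRHS]ger0_norm ?addr_ge0// -sqrtr_sqr ler_sqrt ?sqr_ge0//.
rewrite sqrrD !real_normK ?num_real// mulr2n;
  have := mulr_ge0 (normr_ge0 u) (normr_ge0 v).
lra.
Qed.

Lemma ReIm_le_norm (z : R[i]) (M : R) : `|z| <= M%:C ->
  `|Re z| <= M /\ `|Im z| <= M.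
Proof.
rewrite normc_def lecR => zM; split; apply: le_trans zM;
  rewrite -sqrtr_sqr ler_sqrt ?addr_ge0 ?sqr_ge0//.
  by rewrite lerDl sqr_ge0.
by rewrite lerDr sqr_ge0.
Qed.

Lemma real_mean_value_le (f df : R -> R) x M : 0 <= x ->
    (forall y, y \in `[0, x] -> is_derive y 1 f (df y)) ->
    (forall y, y \in `[0, x] -> `|df y| <= M) ->
  `|f x - f 0| <= M * x.
Proof.
move=> x0 fd dM.
have fd' y : y \in `]0, x[ -> is_derive y 1 f (df y).
  by rewrite in_itv/= => /andP[y0 yx]; apply: fd; rewrite in_itv/= !ltW.
have fc : {within `[0, x], continuous f}%classic.
  by apply: derivable_within_continuous => y /fd[].
have [y yx ->] := MVT_segment x0 fd' fc.
by rewrite subr0 normrM (ger0_norm x0) ler_wpM2r// dM.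
Qed.

(** The real and imaginary parts are bounded separately, whence the factor 2. *)
Lemma mean_value_le f (df : R -> R[i]) x M : 0 <= x ->
    (forall y, y \in `[0, x] -> is_cderive y f (df y)) ->
    (forall y, y \in `[0, x] -> `|df y| <= M%:C) ->
  `|f x - f 0| <= (2 * M * x)%:C.
Proof.
move=> x0 fd dM; apply: le_trans (norm_le_ReIm _) _; rewrite lecR.
rewrite !raddfB -mulrA mulr2n mulrDl mul1r lerD//.
  apply: (@real_mean_value_le (Re \o f) (Re \o df)) => // y yx.
    by have [] := fd y yx.
  by have [] := ReIm_le_norm (dM y yx).
apply: (@real_mean_value_le (Im \o f) (Im \o df)) => // y yx.
  by have [] := fd y yx.
by have [] := ReIm_le_norm (dM y yx).
Qed.

Lemma norm_cpow_le a t : 0 <= t <= 1 -> `|cpow a t| <= (expR `|Re a|)%:C.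
Proof.
move=> /andP[t0 t1]; rewrite norm_cexp lecR ler_expR.
have -> : Re (a * (ln (1 + t))%:C) = Re a * ln (1 + t) by case: a => ? ?; simpc.
have l0 : 0 <= ln (1 + t) by rewrite ln_ge0// lerDl.
have l1 : ln (1 + t) <= 1 by rewrite (le_trans (le_ln1Dx _))// (lt_le_trans _ t0)//
  oppr_lt0.
apply: le_trans (ler_norm _) _; rewrite normrM (ger0_norm l0) -[leRHS]mulr1.
by rewrite ler_wpM2l.
Qed.

Lemma cpow_at0 a : cpow a 0 = 1.
Proof. by rewrite /cpow addr0 ln1 mulr0 /cexp/= expR0 cos0 sin0 mulr1 mulr0. Qed.

Lemma cpow0 t : cpow 0 t = 1.
Proof. by rewrite /cpow mul0r /cexp/= expR0 cos0 sin0 mulr1 mulr0. Qed.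

Lemma normcC (z : R[i]) : (Re `|z|)%:C = `|z|.
Proof. by rewrite normc_def. Qed.

(* By [gbin_poly_ode], the derivative of [(1 + t)^(- a) * S t], with [S] the
   truncated binomial series, is a constant times [(1 + t)^(- a - 1) * t ^+ K]. *)
Lemma cpow_taylor a K : exists M : R, forall t, 0 <= t <= 1 ->
  `|cpow a t - (\poly_(k < K) gbin a k).[t%:C]| <= (M * t ^+ K)%:C.
Proof.
case: K => [|K].
  exists (expR `|Re a|) => t t01.
  by rewrite horner_poly big_ord0 subr0 expr0 mulr1 norm_cpow_le.
set S := \poly_(k < K.+1) _.
pose D := Re `|K.+1%:R * gbin a K.+1|.
pose B := expR `|Re (- a)|.
(* The first factor bounds [cpow a t], [B] bounds [cpow (- a)] on the interval, [D] is the constant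
   of [gbin_poly_ode], and 2 comes from [mean_value_le]. *)
exists (expR `|Re a| * (2 * (B * D))) => t /andP[t0 t1].
pose E (y : R) := cpow (- a) y * S.[y%:C].
have ES : cpow a t - S.[t%:C] = cpow a t * (E 0 - E t).
  rewrite /E cpow_at0 mul1r mulrBr mulrA -cpowD subrr cpow0 mul1r.
  by rewrite horner_coef0 coef_poly /= /gbin big_ord0 mulr1.
have Ed y : y \in `[0, t] -> is_cderive y E
    (cpow (- a) y / (1 + y)%:C * (- (K.+1%:R * gbin a K.+1) * y%:C ^+ K)).
  rewrite in_itv/= => /andP[y0 yt].
  have y1 : -1 < y by rewrite (lt_le_trans _ y0)// oppr_lt0.
  have := is_cderiveM (is_cderive_cpow (- a) y1) (is_cderive_horner y S).
  congr is_cderive.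
  have := congr1 (fun p => p.[y%:C]) (gbin_poly_ode a K).
  rewrite -/S [in RHS]hornerZ [in RHS]hornerXn => <-; rewrite !hornerE.
  have : (1 + y)%:C != 0 by rewrite -(rmorph0 (real_complex R)) (inj_eq (@complexI
    R)) gt_eqF// -ltrBlDl sub0r.
  by rewrite rmorphD rmorph1 => y1'; field.
rewrite ES normrM -mulrA [(_ * _)%:C]rmorphM ler_pM// ?norm_cpow_le ?t0//.
(* One power of [t] is the length of the interval; the other [K] bound [y ^+ K]. *)
have -> : 2 * (B * D) * t ^+ K.+1 = 2 * (B * D * t ^+ K) * t.
  by rewrite exprSr; ring.
rewrite distrC; apply: mean_value_le Ed _ => // y; rewrite in_itv/= => /andP[y0 yt].
have nC (x : R) : 0 <= x -> `|x%:C| = x%:C by move=> x0; rewrite ger0_norm ?ler0c.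
rewrite normrM [X in X * _]normrM normfV [X in _ * X]normrM normrN normrX -(normcC
  (_ * gbin _ _)) -/D.
rewrite !nC ?addr_ge0// -!mulrA !rmorphM/= rmorphXn/=.
have y1 : 1 <= 1 + y by rewrite lerDl.
have D0 : 0 <= D by rewrite -ler0c normcC.
apply: ler_pM => //.
  by rewrite !(mulr_ge0, invr_ge0, exprn_ge0, ler0c, addr_ge0).
  by rewrite norm_cpow_le// y0 (le_trans yt).
rewrite mulrCA ler_wpM2l ?ler0c// (@le_trans _ _ (y%:C ^+ K))//.
  rewrite ler_piMl ?exprn_ge0 ?ler0c// invf_le1.
    by rewrite -[1]/(1%:C) lecR.
  by rewrite -[0]/(0%:C) ltcR (lt_le_trans _ y1).
by rewrite lerXn2r ?nnegrE ?ler0c ?lecR.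
Qed.

End Calculus.

(** * The sequence of powers and its linear recurrences *)

Section PowerSeq.

Variable R : realType.
Implicit Types (a : R[i]).

Lemma power_seqE a n : (0 < n)%N -> power_seq a n = cexp (a * (ln (n%:R : R))%:C).
Proof. by rewrite /power_seq; case: n. Qed.

Lemma power_seq_neq0 a n : (0 < n)%N -> power_seq a n != 0.
Proof.
move=> n0; rewrite power_seqE// -normr_gt0 norm_cexp.
by rewrite -[0]/(0%:C) ltcR expR_gt0.
Qed.

(** Lets n^a be factored out of a relation, leaving a function of 1/n. *)
Lemma power_seqD a n j : (0 < n)%N ->
  power_seq a (n + j) = power_seq a n * cpow a (j%:R / n%:R).
Proof.
move=> n0; rewrite !power_seqE ?addn_gt0 ?n0// /cpow -cexpD -mulrDr -rmorphD.
have n0' : 0 < n%:R :> R by rewrite ltr0n.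
rewrite -lnM ?posrE ?ltr_wpDr ?divr_ge0//.
by rewrite mulrDr mulr1 mulrCA divff ?gt_eqF// mulr1 natrD.
Qed.

Lemma power_seq_nat (k n : nat) : (0 < n)%N -> power_seq k%:R n = n%:R ^+ k :> R[i].
Proof.
move=> n0; rewrite power_seqE// -(rmorph_nat (real_complex R)) -rmorphM/=.
by rewrite cos0 sin0 mulr1 mulr0 expRM_natl lnK ?posrE ?ltr0n// complexr0 rmorphXn
  rmorph_nat.
Qed.

Lemma power_seqN a n : (0 < n)%N -> power_seq (- a) n = (power_seq a n)^-1.
Proof.
move=> n0; apply: (mulfI (power_seq_neq0 a n0)); rewrite mulfV ?power_seq_neq0//.
rewrite !power_seqE// -cexpD -mulrDl subrr mul0r.
by rewrite /cexp/= expR0 cos0 sin0 mulr1 mulr0.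
Qed.

Lemma holonomic_power_int (m : int) : holonomic (power_seq (m%:~R : R[i])).
Proof.
have [A [B [A0 AB]]] : exists A B : {poly R[i]}, A != 0 /\ forall n, (0 < n)%N ->
    A.[n%:R] * power_seq m%:~R n.+1 = B.[n%:R] * power_seq m%:~R n.
  have X1E n : ('X + 1 : {poly R[i]}).[n%:R] = n.+1%:R.
    by rewrite !hornerE -natr1.
  have X10 : 'X + 1 != 0 :> {poly R[i]} by rewrite -size_poly_eq0 size_XaddC.
  case: m => k.
    exists 'X^k, (('X + 1) ^+ k); split=> [|n n0];
      first by rewrite -size_poly_eq0 size_polyXn.
    by rewrite horner_exp hornerX horner_exp X1E -pmulrn !power_seq_nat// mulrC.
  exists (('X + 1) ^+ k.+1), ('X ^+ k.+1); split=> [|n n0]; first by rewrite expf_neq0.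
  rewrite horner_exp X1E horner_exp hornerX NegzE mulrNz !power_seqN// -pmulrn
    !power_seq_nat//.
  by rewrite !mulfV// expf_neq0// pnatr_eq0 -?lt0n.
(* The relation between [A] and [B] is known only for positive [n]; the extra factor ['X] makes it
   trivial at 0, where the sequence has the conventional value 0. *)
exists 1%N, (fun i => if i == ord0 then 'X * A else - ('X * B)); split.
  by exists ord0; rewrite eqxx mulf_neq0// polyX_eq0.
move=> n; rewrite big_ord_recl big_ord1/= subn0 subnn addn0 addn1.
rewrite hornerN mulNr !hornerM !hornerX -!mulrA.
case: n => [|n]; first by rewrite mulr0n !mul0r subrr.
by rewrite AB// subrr.
Qed.

Lemma power_seq_relation_eq0 a d (q : nat -> {poly R[i]}) :
    ~ (exists m : int, a = m%:~R) ->
    (forall n, (0 < n)%N -> \sum_(j < d.+1) (q j).[n%:R] * power_seq a (n + j) = 0) ->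
  forall j : 'I_d.+1, q j = 0.
Proof.
move=> aNint q0.
pose N := \max_(j < d.+1) size (q j).
pose Q j : {poly R[i]} := \poly_(i < N.+1) (q j)`_(N - i).
have sq (j : 'I_d.+1) : (size (q j) <= N)%N by exact: leq_bigmax.
have Q0 n : (0 < n)%N -> \sum_(j < d.+1) (Q j).[n%:R^-1] * cpow a (j%:R / n%:R) = 0.
  move=> n0; have nN0 : n%:R != 0 :> R[i] by rewrite pnatr_eq0 -lt0n.
  apply: (mulfI (expf_neq0 N nN0)); rewrite mulr0.
  apply: (mulfI (power_seq_neq0 a n0)); rewrite mulr0 -[RHS](q0 n n0) !mulr_sumr.
  apply: eq_bigr => j _; rewrite power_seqD//.
  by rewrite -(horner_rev_poly (leqW (sq j)) nN0) -/(Q j); ring.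
have qj0 : forall j : 'I_d.+1, (0 < j)%N -> q j = 0.
  move=> j j0; suff Qj0 : Q j = 0.
    apply/polyP => i; rewrite coef0; have [iN|Ni] := leqP i N; last first.
      by rewrite nth_default// (leq_trans (sq j))// ltnW.
    have := congr1 (fun p : {poly R[i]} => p`_(N - i)) Qj0.
    by rewrite coef0 coef_poly ltnS leq_subr subKn.
  apply: (gbin_relation_eq0 aNint _ j0) => k.
  have [C CP] := cpow_taylor a k.+1.
  have /choice[M MP] (j' : nat) : exists M : R,
      forall x : R[i], `|x| <= 1 -> `|(Q j').[x]| <= M%:C.
    by have [M _ QM] := horner_bounded (Q j'); exists M.
  pose T (j' : nat) : {poly R[i]} := \poly_(i < k.+1) (gbin a i * j'%:R ^+ i).
  (* At t = 1/n this polynomial differs from the zero sum of [Q0] only by Taylor remainders of order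
     t^(k + 1). The threshold [d] ensures j/n <= 1, as [cpow_taylor] requires. *)
  have := @coef_eq0_small R k.+1 (\sum_(j < d.+1) Q j * T j)
    (\sum_(j < d.+1) M j * (C * j%:R ^+ k.+1)) d _ k (ltnSn k).
  rewrite coef_sum => e; rewrite -[RHS]e; last first.
    move=> n dn; have n0 : (0 < n)%N by apply: leq_trans dn.
    have n0R : 0 < n%:R :> R by rewrite ltr0n.
    rewrite horner_sum -[X in `|X|]subr0 -[X in `|_ - X|](Q0 n n0) -sumrB.
    rewrite (le_trans (ler_norm_sum _ _ _))// rmorph_sum mulr_suml ler_sum// => i _.
    rewrite hornerM -mulrBr normrM rmorphM/= -mulrA ler_pM//.
      by apply: MP; rewrite ger0_norm ?invr_ge0// invf_le1 ?ltr0n// ler1n.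
    have -> : (T i).[n%:R^-1] = (\poly_(i < k.+1) gbin a i).[(i%:R / n%:R)%:C].
      rewrite !horner_poly; apply: eq_bigr => l _.
      rewrite [(i%:R / n%:R)%:C]rmorphM fmorphV !rmorph_nat.
      by rewrite exprMn mulrA.
    have -> : (C * i%:R ^+ k.+1)%:C / n%:R ^+ k.+1 = (C * (i%:R / n%:R) ^+ k.+1)%:C.
      by rewrite expr_div_n mulrA [RHS]rmorphM fmorphV rmorphXn rmorph_nat.
    rewrite distrC; apply: CP; rewrite divr_ge0//= ler_pdivrMr// mul1r ler_nat.
    by rewrite (leq_trans (leq_ord i))// ltnW.
  apply: eq_bigr => i _; rewrite coefM; apply: eq_bigr => l _.
  by rewrite [(T i)`_ _]coef_poly ltnS leq_subr.
(* Once the other coefficients vanish, the relation reads q_0(n) n^a = 0 for all n > 0, and n^a is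
   nonzero. *)
move=> j; have [j0|/qj0//] := posnP j.
apply: (@poly_eq0_cofinite _ _ 1) => n n0.
have := q0 n n0; rewrite (bigD1 j)//= big1 ?addr0 => [/eqP|i ij].
  by rewrite mulf_eq0 j0 addn0 (negPf (power_seq_neq0 _ n0)) orbF => /eqP.
by rewrite qj0 ?horner0 ?mul0r// lt0n -j0.
Qed.

End PowerSeq.

Theorem proposition2 (R : realType) (alpha : R[i]) :
  holonomic (power_seq alpha) <-> exists m : int, alpha = m%:~R.
Proof.
split=> [[d [p [[i pi0] p0]]]|[m ->]]; last exact: holonomic_power_int.
apply: contrapT => aNint; move/eqP: pi0; apply.
(* The definition pairs p_i with the shift d - i, so the indices are reversed to let q_j go with the
   shift j. *)
have := @power_seq_relation_eq0 R alpha d (fun j => p (inord (d - j))) aNint _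
  (rev_ord i).
rewrite /= subSS subKn ?leq_ord// inord_val; apply => n _.
rewrite -[RHS](p0 n) [RHS](reindex_inj rev_ord_inj); apply: eq_bigr => j _ /=.
congr (_.[_] * power_seq _ (_ + _)); last by rewrite subSS subKn// leq_ord.
by congr p; apply: val_inj; rewrite /= subSS inordK// ltnS leq_subr.
Qed.
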